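(* Let $z\in Z$ and set $\ell=\mathbb{Q}(\sqrt{z})$. (i) If $z=-1$, then $S(\ell)=\{w\in Z\mid w<0\}\setminus\{-1\}$ is a transversal of $(\mathbb{Q}^*/(\mathbb{Q}^*\cap \ell_{\mathrm{sq}}))^\circ$. (ii) If $z\neq -1$, then $S(\ell)=\{w\in Z : |\gcd(z,w)|<\sqrt{|z|}\}$ is a transversal of $(\mathbb{Q}^*/(\mathbb{Q}^*\cap \ell_{\mathrm{sq}}))^\circ$.
   Context: $Z$ denotes the set of all square-free integers (positive or negative, non-zero) except $1$; thus $-1\in Z$. For a ring $R$ and $S\subset R$, $S^*=S\setminus\{0\}$ and $S_{\mathrm{sq}}=\{s^2\mid s\in S\}$; in particular $\ell_{\mathrm{sq}}$ is the set of squares of elements of $\ell$, and $\mathbb{Q}^*\cap\ell_{\mathrm{sq}}$ is a subgroup of the multiplicative group $\mathbb{Q}^*$. For a group $G$ with identity $e$, $G^\circ=G\setminus\{e\}$ (the punctured group). For a subgroup $H\le\mathbb{Q}^*$, a transversal of $(\mathbb{Q}^*/H)^\circ$ is a subset of $\mathbb{Q}^*$ containing exactly one element of each coset of $H$ different from $H$ itself, and no element of $H$. *)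

(* Defs.v *)
From HB Require Import structures.
From mathcomp Require Import all_boot all_order all_algebra all_field.
From mathcomp Require Import boolp classical_sets.

Set Implicit Arguments.
Unset Strict Implicit.
Unset Printing Implicit Defensive.

Import Order.TTheory GRing.Theory Num.Theory.
Local Open Scope classical_set_scope.
Local Open Scope ring_scope.

Definition squarefree (w : int) : Prop :=
  w != 0 /\ forall d : int, (d ^+ 2 %| w)%Z -> d \is a GRing.unit.

Definition Zsf : set int := [set w | squarefree w /\ w != 1].

(* [subFExtend iota s p] is the field obtained by adjoining [s] to the image of
   [iota], provided that [p] is a nonzero polynomial with root [s]; see
   [Qsqrt_poly_neq0] and [Qsqrt_poly_root] for these two conditions. *)
Definition Qsqrt_poly (z : int) : {poly rat} := 'X^2 - (z%:~R)%:P.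

Definition Qsqrt (z : int) : fieldType :=
  subFExtend (ratr : rat -> algC) (sqrtC z%:~R) (Qsqrt_poly z).

Lemma Qsqrt_poly_neq0 (z : int) : Qsqrt_poly z != 0.
Proof. by rewrite monic_neq0 // monicXnsubC. Qed.

Lemma Qsqrt_poly_root (z : int) :
  root (map_poly (ratr : rat -> algC) (Qsqrt_poly z)) (sqrtC z%:~R).
Proof.
rewrite /Qsqrt_poly rmorphB /= map_polyXn map_polyC /= ratr_int.
by rewrite rootE !hornerE sqrtCK subrr.
Qed.

Definition squares (R : pzRingType) (S : set R) : set R :=
  [set s ^+ 2 | s in S].

Definition Qstar : set rat := [set q | q != 0].

(* The map [ratr] is the embedding of the rationals into the field [K]. *)
Definition Qstar_squares (K : fieldType) : set rat :=
  Qstar `&` [set q | squares [set: K] (ratr q)].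

Definition mulcoset (q : rat) (H : set rat) : set rat := [set q * h | h in H].

Definition punctured_quotient (H : set rat) : set (set rat) :=
  [set mulcoset q H | q in Qstar] `\ H.

Definition punctured_transversal (H T : set rat) : Prop :=
  [/\ T `<=` Qstar, T `&` H = set0
    & forall C, punctured_quotient H C -> exists! t, (T `&` C) t].

Definition S_gauss : set int := [set w | Zsf w /\ w < 0] `\ (-1).

(* [sqrtC] of a nonnegative number is its nonnegative square root, and the order
   of [algC] restricts to the usual one on real numbers. *)
Definition S_gcd (z : int) : set int :=
  [set w | Zsf w /\ `|gcdz z w|%:~R < sqrtC (`|z|%:~R) :> algC].

(* Main.v *)
Require Import Defs.
From HB Require Import structures.
From mathcomp Require Import all_boot all_order all_algebra all_field.
From mathcomp Require Import boolp classical_sets.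
From mathcomp Require Import ring zify.

Set Implicit Arguments.
Unset Strict Implicit.
Unset Printing Implicit Defensive.

Import Order.TTheory GRing.Theory Num.Theory.
Local Open Scope classical_set_scope.
Local Open Scope ring_scope.

(** Write H for the group of nonzero rationals that become squares in
    Q(sqrt z).  Squaring a + b sqrt z shows that H consists of the nonzero
    rationals r^2 and z r^2 ([Qstar_squaresP]).  Every nonzero rational is
    w r^2 for exactly one square-free integer w ([squarefree_part_rat],
    [squarefree_inj]), so the square-free integers represent Q^* modulo squares
    and the further quotient by z identifies w with the square-free part of
    z w.  With g = gcd(z, w) this is w^ = (z / g) (w / g), called [partner]
    below: each coset of H contains exactly the two square-free integers w and
    w^ ([mulcoset_squarefree]), and H itself contains 1 and z.

    A set of square-free integers is therefore a transversal of the punctured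
    quotient as soon as it avoids 1 and z and selects exactly one element of
    every other pair {w, w^} ([transversal_of_selector]).  For z = -1 the pair is
    {w, -w}, and the sign selects.  For the other z,
    gcd(z, w) gcd(z, w^) = |z| ([gcd_partner]), and |z| is not a perfect square
    because z is square-free and is not a unit; hence exactly one of the two
    gcds is smaller than sqrt |z|. *)

(** * Square-free integers *)

Lemma unitz_dvd1 (d : int) : (d \is a GRing.unit) = (d %| 1)%Z.
Proof.
rewrite dvdz1; apply/idP/eqP => [|d1].
  by rewrite qualifE => /orP[] /eqP ->.
by rewrite qualifE /=; case: d d1 => [] [|[|?]].
Qed.

Lemma unitz_sqr (d : int) : d \is a GRing.unit -> d ^+ 2 = 1.
Proof. by rewrite unitz_dvd1 dvdz1 => /eqP d1; nia. Qed.

Lemma squarefree_neq0 w : squarefree w -> w != 0.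
Proof. by case. Qed.

Lemma squarefree1 : squarefree 1.
Proof.
split=> // d; rewrite unitz_dvd1; apply: dvdz_trans.
exact: dvdz_mulr.
Qed.

Lemma squarefreeN w : squarefree w -> squarefree (- w).
Proof.
case=> w0 sf; split=> [|d]; first by rewrite oppr_eq0.
by rewrite dvdzE abszN -dvdzE; exact: sf.
Qed.

Lemma squarefree_dvd d w : (d %| w)%Z -> squarefree w -> squarefree d.
Proof.
move=> dw [w0 sf]; split.
  by apply: contraNneq w0 => d0; move: dw; rewrite d0 dvd0z.
by move=> e ed; apply: sf; apply: dvdz_trans dw.
Qed.

Lemma squarefree_coprime u v : squarefree (u * v) -> coprimez u v.
Proof.
case=> _ /(_ (gcdz u v)); rewrite unitz_dvd1 expr2.
move=> /(_ (dvdz_mul (dvdz_gcdl _ _) (dvdz_gcdr _ _))).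
by rewrite dvdz1.
Qed.

(** If d^2 divides u v, then gcd(d, u), as a divisor of u, is coprime to v, so its
    square divides u and it is a unit; thus d is coprime to u and d^2 divides v. *)
Lemma squarefreeM u v :
  squarefree u -> squarefree v -> coprimez u v -> squarefree (u * v).
Proof.
move=> [u0 sfu] [v0 sfv] cuv; split=> [|d d2]; first by rewrite mulf_neq0.
have cdu : coprimez d u.
  suff : gcdz d u \is a GRing.unit by rewrite unitz_dvd1 dvdz1.
  apply: sfu; rewrite -(@Gauss_dvdzl _ _ v).
    by apply: dvdz_trans d2; rewrite dvdz_exp2r // dvdz_gcdl.
  rewrite coprimezXl //; apply: coprimez_dvdl cuv; exact: dvdz_gcdr.
by apply: sfv; rewrite -(@Gauss_dvdzr _ u) // coprimezXl.
Qed.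

(** Dividing m by d^2 for a non-unit d decreases |m|, which allows strong
    induction on |m|. *)
Lemma squarefree_part_int (m : int) :
  m != 0 -> exists w k, [/\ squarefree w, k != 0 & m = w * k ^+ 2].
Proof.
have [n] := ubnP `|m|%N; elim: n m => // n IH m mn m0.
have [sf|/not_andP[/(_ m0)//|]] := pselect (squarefree m).
  by exists m, 1; split=> //; rewrite mulr1.
move=> /existsNP[d /not_implyP[/dvdzP[m' mE] /negP du]].
have m'0 : m' != 0 by apply: contraNneq m0 => z0; rewrite mE z0 mul0r.
have d0 : d != 0 by apply: contraNneq m0 => z0; rewrite mE z0 mulr0.
have d1 : `|d|%N != 1 by move: du; rewrite unitz_dvd1 dvdz1.
have [|w [k [sfw k0 m'E]]] := IH m' _ m'0.
  by move: mn; rewrite mE abszM abszX; nia.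
exists w, (k * d); split=> //; first by rewrite mulf_neq0.
by rewrite mE m'E; ring.
Qed.

(** The square class of a fraction n / d is that of the integer n d. *)
Lemma squarefree_part_rat (q : rat) :
  q != 0 -> exists w r, [/\ squarefree w, r != 0 & q = w%:~R * r ^+ 2].
Proof.
move=> q0; have dr0 : (denq q)%:~R != 0 :> rat by rewrite intr_eq0 denq_neq0.
have [|w [k [sfw k0 E]]] := @squarefree_part_int (numq q * denq q).
  by rewrite mulf_neq0 ?denq_neq0 // numq_eq0.
exists w, (k%:~R / (denq q)%:~R); split=> //.
  by rewrite mulf_neq0 ?invr_eq0 ?intr_eq0.
move/(congr1 (intr : int -> rat)): E.
rewrite !(rmorphXn, rmorphM) /= numqE => E.
by rewrite expr_div_n mulrA -E; field.
Qed.

(** Writing r = n / d in lowest terms gives w d^2 = w' n^2, where n^2 and d^2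
    are coprime: n^2 divides w and d^2 divides w', so both are 1. *)
Lemma squarefree_inj w w' (r : rat) :
  squarefree w -> squarefree w' -> w%:~R = w'%:~R * r ^+ 2 -> w = w'.
Proof.
move=> [w0 sf] [w'0 sf'] E.
have E' : w * denq r ^+ 2 = w' * numq r ^+ 2.
  apply: (@intr_inj rat); rewrite !(rmorphXn, rmorphM) /= E numqE; ring.
have co : coprimez (numq r) (denq r) by rewrite coprimezE coprime_num_den.
have n1 : numq r ^+ 2 = 1.
  apply/unitz_sqr/sf; rewrite -(@Gauss_dvdzl _ _ (denq r ^+ 2)).
    by rewrite E' dvdz_mull.
  by rewrite coprimezXl // coprimezXr.
have d1 : denq r ^+ 2 = 1.
  apply/unitz_sqr/sf'; rewrite -(@Gauss_dvdzl _ _ (numq r ^+ 2)).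
    by rewrite -E' dvdz_mull.
  by rewrite coprimezXl // coprimezXr // coprimez_sym.
by move: E'; rewrite n1 d1 !mulr1.
Qed.

(** * The square-free part of z w *)

(** For square-free z and w this is the square-free part of z w: [partnerE] and
    [squarefree_partner] characterize it. *)
Definition partner (z w : int) : int :=
  (z %/ gcdz z w)%Z * (w %/ gcdz z w)%Z.

Lemma partnerE z w : z * w = partner z w * gcdz z w ^+ 2.
Proof.
by rewrite /partner expr2 mulrACA !divzK ?dvdz_gcdl ?dvdz_gcdr.
Qed.

(** The form in which partners are compared in Q^* modulo squares. *)
Lemma partner_ratE z w :
  z%:~R * w%:~R = (partner z w)%:~R * (gcdz z w)%:~R ^+ 2 :> rat.
Proof. by rewrite -rmorphXn -!rmorphM -partnerE. Qed.

Lemma gcdz_neq0l z w : z != 0 -> gcdz z w != 0.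
Proof. by rewrite gcdz_eq0 => /negPf ->. Qed.

Lemma coprime_div_gcd z w : z != 0 ->
  coprimez (z %/ gcdz z w)%Z (w %/ gcdz z w)%Z.
Proof.
move=> z0; have g0 := gcdz_neq0l w z0.
rewrite /coprimez -(inj_eq (mulIf g0)) mul1r.
have gE : gcdz z w = `|gcdz z w|%N by rewrite /gcdz absz_nat.
by rewrite {3}gE mulz_gcdl !divzK ?dvdz_gcdl ?dvdz_gcdr.
Qed.

Lemma squarefree_partner z w :
  squarefree z -> squarefree w -> squarefree (partner z w).
Proof.
move=> sz sw; apply: squarefreeM.
- apply: squarefree_dvd sz; apply/dvdzP; exists (gcdz z w).
  by rewrite mulrC divzK ?dvdz_gcdl.
- apply: squarefree_dvd sw; apply/dvdzP; exists (gcdz z w).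
  by rewrite mulrC divzK ?dvdz_gcdr.
- exact: coprime_div_gcd (squarefree_neq0 sz).
Qed.

(** Put u = z / g and v = w / g.  Since w = v g is square-free, g is coprime to
    v, so gcd(z, u v) = gcd(u g, u v) = |u|. *)
Lemma gcd_partner z w : squarefree z -> squarefree w ->
  gcdz z w * gcdz z (partner z w) = `|z|.
Proof.
move=> sz sw; have z0 := squarefree_neq0 sz.
rewrite /partner; set g := gcdz z w; set u := (z %/ g)%Z; set v := (w %/ g)%Z.
have zE : z = u * g by rewrite divzK ?dvdz_gcdl.
have wE : w = v * g by rewrite divzK ?dvdz_gcdr.
have /eqP cgv : coprimez g v.
  by apply: squarefree_coprime; rewrite mulrC -wE.
have -> : gcdz z (u * v) = `|u| by rewrite {1}zE -mulz_gcdr cgv mulr1 abszE.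
by rewrite {1}zE normrM mulrC; congr (_ * _).
Qed.

(** * The rationals that are squares in Q(sqrt z) *)

Lemma Qsqrt_coordinates z (x : Qsqrt z) :
  exists a b : rat, subfx_inj x = ratr a + ratr b * sqrtC z%:~R :> algC.
Proof.
have [p ->] := subfxE x.
have sE := sqrtCK (z%:~R : algC).
rewrite (subfx_inj_eval (Qsqrt_poly_root z) (Qsqrt_poly_neq0 z)).
elim/poly_ind: p => [|p c [a [b E]]].
  by exists 0, 0; rewrite rmorph0 horner0 rmorph0 mul0r addr0.
exists (c + b * z%:~R), a.
rewrite rmorphD rmorphM /= map_polyX map_polyC /= !hornerE E.
rewrite rmorphD rmorphM /= ratr_int; set s := sqrtC _ in sE *.
by rewrite -sE; ring.
Qed.

(** If q = (a + b s)^2 with s = sqrt z, then 2 a b s is rational.  Either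
    a b = 0, and q is b^2 z or a^2; or s is itself rational, and a + b s is a
    rational square root of q. *)
Lemma Qstar_squaresP z (q : rat) :
  Qstar_squares (Qsqrt z) q <->
  q != 0 /\ exists r, q = r ^+ 2 \/ q = z%:~R * r ^+ 2.
Proof.
pose s : algC := sqrtC z%:~R; have sE : s ^+ 2 = z%:~R := sqrtCK _.
pose inj : {rmorphism Qsqrt z -> algC} := subfx_inj.
have ratr_injC := fmorph_inj (ratr : {rmorphism rat -> algC}).
split=> [[q0 [x _ xE]]|[q0 [r qE]]]; split=> //.
  have {xE} := congr1 inj xE.
  rewrite fmorph_rat rmorphXn /=.
  have [a [b ->]] := Qsqrt_coordinates x.
  rewrite -/s => E.
  have E' : ratr q = ratr (a ^+ 2 + b ^+ 2 * z%:~R) + ratr (2 * a * b) * s.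
    rewrite !(rmorphD, rmorphM, rmorphXn) /= ratr_int -sE -E.
    by rewrite rmorph1; ring.
  have [ab0|ab0] := eqVneq (2 * a * b) 0.
    rewrite ab0 rmorph0 mul0r addr0 in E'; have {}E' := ratr_injC _ _ E'.
    have /orP[/eqP a0|/eqP b0] : (a == 0) || (b == 0).
      by move/eqP: ab0; rewrite !mulf_eq0 pnatr_eq0.
    - by exists b; right; rewrite E' a0 expr0n add0r mulrC.
    - by exists a; left; rewrite E' b0 expr0n mul0r addr0.
  have [r sr] : exists r, s = ratr r.
    exists ((q - (a ^+ 2 + b ^+ 2 * z%:~R)) / (2 * a * b)).
    rewrite fmorph_div rmorphB /= E' addrAC subrr add0r mulrC mulKf //.
    by rewrite fmorph_eq0.
  exists (a + b * r); left; apply: ratr_injC.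
  by apply: etrans (esym E) _; rewrite sr rmorphXn rmorphD rmorphM.
case: qE => ->.
  exists (ratr r) => //; apply: (fmorph_inj inj).
  by rewrite rmorphXn !fmorph_rat rmorphXn.
pose t : Qsqrt z := subfx_root _ _ _.
have tE : inj t = s := subfx_inj_root (Qsqrt_poly_root z) (Qsqrt_poly_neq0 z).
exists (t * ratr r) => //; apply: (fmorph_inj inj).
rewrite rmorphXn rmorphM !fmorph_rat tE exprMn sqrtCK.
by rewrite rmorphM rmorphXn /= ratr_int.
Qed.

Lemma Qstar_squaresM z q r :
  Qstar_squares (Qsqrt z) q -> Qstar_squares (Qsqrt z) r ->
  Qstar_squares (Qsqrt z) (q * r).
Proof.
move=> /Qstar_squaresP[q0 [a qE]] /Qstar_squaresP[r0 [b rE]].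
apply/Qstar_squaresP; split; first exact: mulf_neq0.
case: qE rE => -> [] ->.
- by exists (a * b); left; ring.
- by exists (a * b); right; ring.
- by exists (a * b); right; ring.
- by exists (z%:~R * a * b); left; ring.
Qed.

Lemma mulcoset_id z q : Qstar_squares (Qsqrt z) q ->
  mulcoset q (Qstar_squares (Qsqrt z)) = Qstar_squares (Qsqrt z).
Proof.
move=> Hq; have [q0 _] := Hq.
apply/seteqP; split=> [_ [h Hh <-]|h Hh]; first exact: Qstar_squaresM.
(* [h / q] is written as [h * q] times a square, which avoids inverses in the
   group. *)
exists (h * q * q^-1 ^+ 2); last by field.
apply: Qstar_squaresM; first exact: Qstar_squaresM.
by apply/Qstar_squaresP; split; [rewrite sqrf_eq0 invr_eq0|exists q^-1; left].
Qed.

(** * Cosets and transversals *)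

(** The factor r^2 allows for the coset of an arbitrary nonzero rational, in the
    form given by [squarefree_part_rat].  The two alternatives for [w'] come from
    the two kinds of elements of the subgroup, r^2 and z r^2. *)
Lemma mulcoset_squarefree z w w' (r : rat) :
  squarefree z -> squarefree w -> squarefree w' -> r != 0 ->
  mulcoset (w%:~R * r ^+ 2) (Qstar_squares (Qsqrt z)) w'%:~R <->
  w' = w \/ w' = partner z w.
Proof.
move=> sz sw sw' r0.
have z0 : z%:~R != 0 :> rat by rewrite intr_eq0 squarefree_neq0.
have g0 : (gcdz z w)%:~R != 0 :> rat.
  by rewrite intr_eq0 gcdz_neq0l // squarefree_neq0.
have pE := partner_ratE z w.
split=> [[h /Qstar_squaresP[_ [s [->|->]]] E]|[->|->]].
- by left; apply: (@squarefree_inj _ _ (r * s)); rewrite // -E; ring.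
- right; apply: (@squarefree_inj _ _ ((gcdz z w)%:~R * r * s)) => //.
    exact: squarefree_partner.
  transitivity (z%:~R * w%:~R * (r * s) ^+ 2 : rat); first by rewrite -E; ring.
  by rewrite pE; ring.
- exists (r^-1 ^+ 2); last by field.
  by apply/Qstar_squaresP; split; [rewrite sqrf_eq0 invr_eq0|exists r^-1; left].
- exists (z%:~R * (r^-1 / (gcdz z w)%:~R) ^+ 2).
    apply/Qstar_squaresP; split; last by eexists; right.
    by rewrite mulf_neq0 ?sqrf_eq0 ?mulf_neq0 ?invr_eq0.
  transitivity (z%:~R * w%:~R / (gcdz z w)%:~R ^+ 2 : rat).
    by field; apply/andP.
  by rewrite pE; field.
Qed.

(** The trivial coset is that of w = 1, whose partner is z. *)
Lemma Qstar_squares_squarefree z w : squarefree z -> squarefree w ->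
  Qstar_squares (Qsqrt z) w%:~R <-> w = 1 \/ w = z.
Proof.
move=> sz sw; have := mulcoset_squarefree sz squarefree1 sw (oner_neq0 rat).
have -> : partner z 1 = z by rewrite /partner gcdz1 !divz1 mulr1.
rewrite expr1n mulr1 mulcoset_id //; apply/Qstar_squaresP; split=> //.
by exists 1; left; rewrite expr1n.
Qed.

(** Both parts of the theorem are instances: they differ only in the rule [P]
    that selects one member of each pair of partners. *)
Lemma transversal_of_selector z (P : set int) : squarefree z ->
  (forall w, P w -> [/\ squarefree w, w <> 1 & w <> z]) ->
  (forall w, squarefree w -> w <> 1 -> w <> z -> P (partner z w) <-> ~ P w) ->
  punctured_transversal (Qstar_squares (Qsqrt z)) [set (w%:~R : rat) | w in P].
Proof.
move=> sz PZ Psel; split.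
- by move=> _ [w /PZ[sw _ _] <-]; rewrite /Qstar /= intr_eq0 squarefree_neq0.
- rewrite -subset0 => _ [[w /PZ[sw w1 wz] <-]].
  by rewrite (Qstar_squares_squarefree sz sw) => -[].
- move=> _ [[q q0 <-] neqH].
  have [w [r [sw r0 qE]]] := squarefree_part_rat q0.
  have wH : ~ Qstar_squares (Qsqrt z) w%:~R.
    move=> Hw; apply: neqH; apply: mulcoset_id; rewrite qE.
    apply: Qstar_squaresM => //.
    by apply/Qstar_squaresP; split; [rewrite sqrf_eq0|exists r; left].
  have [w1 wz] : w <> 1 /\ w <> z.
    by split=> E; apply/wH/(Qstar_squares_squarefree sz sw); [left|right].
  have sel := Psel w sw w1 wz.
  rewrite qE.
  have [t [Pt tE uniq]] : exists t, [/\ P t, t = w \/ t = partner z w &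
      forall t', P t' -> t' = w \/ t' = partner z w -> t' = t].
    have [Pw|nPw] := pselect (P w).
      exists w; split=> //; first by left.
      by move=> t' Pt' [//|E]; case: (sel.1 _ Pw); rewrite -E.
    exists (partner z w); split; [exact/sel.2 | by right|].
    by move=> t' Pt' [E|//]; case: nPw; rewrite -E.
  have mem t' : P t' ->
      mulcoset (w%:~R * r ^+ 2) (Qstar_squares (Qsqrt z)) t'%:~R <->
      t' = w \/ t' = partner z w.
    by case/PZ=> st' _ _; exact: mulcoset_squarefree.
  exists t%:~R; split; first by split; [exists t|exact/mem].
  by move=> _ [[t' Pt' <-] /(mem _ Pt') t'E]; rewrite (uniq t').
Qed.

(** Squaring turns the comparison with sqrt |z| into one between integers, where
    g^2 can be compared with g g' = |z|. *)
Lemma S_gcdE z w :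
  S_gcd z w <-> [/\ squarefree w, w <> 1 & gcdz z w ^+ 2 < `|z|].
Proof.
rewrite /S_gcd /Zsf /=.
have -> : (`|gcdz z w|%:~R < sqrtC (`|z|%:~R) :> algC) =
    (gcdz z w ^+ 2 < `|z|).
  rewrite -[X in X < _]sqrCK ?ler0z //.
  rewrite ltr_sqrtC ?qualifE /= ?exprn_ge0 ?ler0z //.
  by rewrite -rmorphXn ltr_int real_normK // num_real.
by split=> [[[sw /eqP w1] h]|[sw /eqP w1 h]].
Qed.

Lemma partner_eq1 z w :
  squarefree z -> squarefree w -> partner z w = 1 -> w = z.
Proof.
move=> sz sw pE.
have z0 : z%:~R != 0 :> rat by rewrite intr_eq0 squarefree_neq0.
apply: (@squarefree_inj _ _ ((gcdz z w)%:~R / z%:~R)) => //.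
have := partner_ratE z w; rewrite pE mul1r expr_div_n => <-.
by field.
Qed.

Theorem proposition2p1 (z : int) (hz : Zsf z) :
  (z = -1 ->
     punctured_transversal (Qstar_squares (Qsqrt z))
       [set (w%:~R : rat) | w in S_gauss]) /\
  (z <> -1 ->
     punctured_transversal (Qstar_squares (Qsqrt z))
       [set (w%:~R : rat) | w in S_gcd z]).
Proof.
have [sz /eqP z1] := hz; split=> zN1; apply: transversal_of_selector => //.
- by move=> w [[[sw /eqP w1] _] wN1]; split=> //; rewrite zN1.
- move=> w sw /eqP w1; rewrite zN1 => wN1.
  have w0 := squarefree_neq0 sw.
  have -> : partner (-1) w = - w.
    have := partnerE (-1) w.
    have -> : gcdz (-1) w = 1 by rewrite gcdNz gcd1z.
    by rewrite expr1n mulr1 mulN1r.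
  split=> [[[_ wlt] _] [[_ wlt'] _]|nS]; first by lia.
  have wgt : ~ w < 0 by move=> wlt; apply: nS.
  split; last by move=> /=; lia.
  split; last by lia.
  by split; [exact: squarefreeN | apply/eqP; lia].
- move=> w /S_gcdE[sw w1 ltz]; split=> // wz.
  by move: ltz; rewrite wz gcdzz; have := squarefree_neq0 sz; nia.
- move=> w sw w1 wz; rewrite !S_gcdE.
  have gE := gcd_partner sz sw.
  have ge0 v : 0 <= gcdz z v by [].
  (* Otherwise g^2 divides the square-free z, so |z| = g^2 = 1. *)
  have gne : gcdz z w ^+ 2 <> `|z|.
    move=> E.
    have : gcdz z w ^+ 2 = 1.
      apply/unitz_sqr/sz.2; rewrite E.
      by apply/dvdzP; exists (Num.sg z); rewrite -numEsg.
    by lia.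
  have zgt0 : 0 < `|z| by rewrite normr_gt0 squarefree_neq0.
  have sp := squarefree_partner sz sw.
  have p1 : partner z w <> 1 by move/(partner_eq1 sz sw).
  move: (gcdz z w) (gcdz z (partner z w)) (ge0 w) (ge0 (partner z w)) gE gne.
  move=> g g' g0 g'0 gE gne.
  split=> [[_ _ lt'] [_ _ lt]|nlt]; first by nia.
  split=> //.
  have {nlt} : ~ g ^+ 2 < `|z| by move=> lt; apply: nlt.
  by nia.
Qed.
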